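(* For integers $n\ge 1$ let $f(n)=\#\{k : 1\le k\le n,\ k\equiv n \pmod{2^k}\}$. Then $f(1)=1$ and, for all integers $i\ge 0$ and $1\le j\le 2^i$, $$ f(2^i+j)=\begin{cases} f(j)+1 & \text{if } 1\le j\le i,\\ f(j) & \text{if } i+1\le j\le 2^i.\end{cases} $$ *)

(* Defs.v *)
From mathcomp Require Import all_boot.

Set Implicit Arguments.
Unset Strict Implicit.
Unset Printing Implicit Defensive.

(* The type 'I_n.+1 is {0, ..., n}; the index 0 is removed explicitly.        *)
Definition f (n : nat) : nat :=
  #|[set k : 'I_n.+1 | (1 <= k <= n) && (k == n %[mod 2 ^ k])]|.

(* Main.v *)
Require Import Defs.
From mathcomp Require Import all_boot.

(** If [0 < n <= 2^k] and [0 < k], then [k = n %[mod 2^k]] forces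
    [k = n]. Hence, when [i < n <= 2^(i+1)], the only index [k > i] counted by [f n] is [k = n],
    while the indices [k <= i] do not distinguish [2^i + j] from [j]. *)

Lemma f_sum n : f n = \sum_(1 <= k < n.+1) (k == n %[mod 2 ^ k]).
Proof.
rewrite /f -sum1dep_card big_mkcond /=.
rewrite -(big_mkord xpredT
  (fun k => if (1 <= k <= n) && (k == n %[mod 2 ^ k]) then 1 else 0)).
rewrite big_ltn //= add0n; apply: eq_big_nat => k /andP[k_gt0].
by rewrite ltnS k_gt0 => -> /=; case: eqP.
Qed.

Lemma eq_mod_exp2 k n : 0 < k -> 0 < n <= 2 ^ k ->
  (k == n %[mod 2 ^ k]) = (k == n).
Proof.
move=> k_gt0 /andP[n_gt0]; have lt_k : k < 2 ^ k by apply: ltn_expl.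
(* In the boundary case [n = 2 ^ k] the residue of [n] is 0, while [0 < k < n], so both sides are
   false. *)
rewrite leq_eqVlt (modn_small lt_k) => /predU1P[-> | /modn_small -> //].
by rewrite modnn (gtn_eqF k_gt0) (ltn_eqF lt_k).
Qed.

Lemma f_split i n : i < n <= 2 ^ i.+1 ->
  f n = (\sum_(1 <= k < i.+1) (k == n %[mod 2 ^ k])).+1.
Proof.
move=> /andP[lt_in le_n]; rewrite f_sum (@big_cat_nat _ _ _ i.+1) ?(leqW lt_in) //=.
have n_gt0 : 0 < n by apply: leq_trans lt_in.
(* The successor is the term [k = n]; terms with [i < k < n] vanish because
   [n <= 2 ^ i.+1 <= 2 ^ k]. *)
rewrite -[RHS]addn1; congr (_ + _); rewrite big_nat_recr //= eqxx big_nat big1 // => k.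
case/andP=> lt_ik lt_kn; have k_gt0 : 0 < k by apply: leq_trans lt_ik.
rewrite eq_mod_exp2 ?(ltn_eqF lt_kn) // n_gt0.
by rewrite (leq_trans le_n) 1?leq_exp2l.
Qed.

(** The added indices [k > n] contribute nothing, since [n < k < 2 ^ k] rules out the congruence. *)
Lemma f_widen i n : 0 < n <= i ->
  f n = \sum_(1 <= k < i.+1) (k == n %[mod 2 ^ k]).
Proof.
case/andP=> n_gt0 le_ni; rewrite f_sum [RHS](@big_cat_nat _ _ _ n.+1) //=.
rewrite [X in _ + X]big_nat [X in _ + X]big1 ?addn0 // => k /andP[lt_nk _].
rewrite eq_mod_exp2 ?(gtn_eqF lt_nk) ?n_gt0 //; first exact: leq_trans lt_nk.
by rewrite ltnW // (ltn_trans lt_nk) 1?ltn_expl.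
Qed.

Theorem theorem6 :
  f 1 = 1 /\
  (forall i j : nat, 1 <= j <= 2 ^ i ->
     f (2 ^ i + j) = if j <= i then f j + 1 else f j).
Proof.
split; first by rewrite (@f_split 0) // big_geq.
move=> i j /andP[j_gt0 le_j]; rewrite (@f_split i); last first.
  by rewrite expnS mul2n -addnn leq_add2l le_j ltn_addr 1?ltn_expl.
have -> : \sum_(1 <= k < i.+1) (k == 2 ^ i + j %[mod 2 ^ k]) =
          \sum_(1 <= k < i.+1) (k == j %[mod 2 ^ k]).
  apply: eq_big_nat => k /andP[_ lt_ki].
  by rewrite -modnDml (eqP (dvdn_exp2l 2 (lt_ki : k <= i))) add0n.
(* If [j <= i], the common sum is all of [f j], and the extra 1 from [k = 2 ^ i + j] remains. If
   [i < j], the sum misses the index [k = j] of [f j], which makes up for that 1. *)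
case: leqP => [le_ji | lt_ij]; first by rewrite addn1 (@f_widen i) ?j_gt0.
by rewrite (@f_split i) // lt_ij (leq_trans le_j) 1?leq_exp2l.
Qed.
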